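(* Let $R$ be a ring. The following statements are equivalent: (1) $R$ satisfies the descending chain condition on $sh$-ideals. (2) $R$ satisfies the descending chain condition on finite sums of non-comparable $sh$-ideals, i.e. on the ideals of the form $\sum_{L\in\Delta}L$ where $\Delta$ is a finite set of $sh$-ideals of $R$ that are pairwise incomparable under inclusion.
   Context: All rings are associative with $1\neq 0$ (not necessarily commutative); ''ideal'' means two-sided ideal. An ideal $L$ of $R$ is strongly hollow (an $sh$-ideal) if for all ideals $A,B$ of $R$, $L\subseteq A+B$ implies $L\subseteq A$ or $L\subseteq B$. The descending chain condition on a class of ideals means that every chain $I_1\supseteq I_2\supseteq\cdots$ of members of the class is eventually constant. *)

(* Defs.v *)
From HB Require Import structures.
From mathcomp Require Import all_boot all_order all_algebra.
From mathcomp Require Import mathcomp_extra boolp classical_sets functions.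
From mathcomp Require Import cardinality fsbigop.
Set Implicit Arguments.
Unset Strict Implicit.
Unset Printing Implicit Defensive.
Import GRing.Theory.
Local Open Scope classical_set_scope.
Local Open Scope ring_scope.

(* Subsets are Prop-valued rather than {pred R}, so that no decidability of
   membership is built into the notion of ideal. The whole ring and the zero
   ideal are ideals. *)
Definition two_sided_ideal (R : nzRingType) (I : set R) : Prop :=
  [/\ I 0,
      forall x y, I x -> I y -> I (x - y),
      forall a x, I x -> I (a * x)
    & forall a x, I x -> I (x * a)].

Definition ideal_add (R : nzRingType) (A B : set R) : set R :=
  [set a + b | a in A & b in B].

Definition sh_ideal (R : nzRingType) (L : set R) : Prop :=
  two_sided_ideal L /\
  forall A B : set R, two_sided_ideal A -> two_sided_ideal B ->
    L `<=` ideal_add A B -> L `<=` A \/ L `<=` B.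

(* The sum of the members of Delta, intended for finite Delta. It is {0} when
   Delta is empty. *)
Definition ideal_sum (R : nzRingType) (Delta : set (set R)) : set R :=
  [set x | exists f : set R -> R,
     (forall L, Delta L -> L (f L)) /\ x = \sum_(L \in Delta) f L].

Definition pairwise_incomparable (T : Type) (Delta : set (set T)) : Prop :=
  forall L M : set T, Delta L -> Delta M -> L <> M ->
    ~ (L `<=` M) /\ ~ (M `<=` L).

Definition incomparable_sh_sum (R : nzRingType) (I : set R) : Prop :=
  exists Delta : set (set R),
    [/\ finite_set Delta,
        Delta `<=` @sh_ideal R,
        pairwise_incomparable Delta
      & I = ideal_sum Delta].

Definition dcc (T : Type) (P : set (set T)) : Prop :=
  forall I : nat -> set T,
    (forall n, P (I n)) -> (forall n, I n.+1 `<=` I n) ->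
    exists N, forall n, (N <= n)%N -> I n = I N.

(* Main.v *)
(* If a sum of sh-ideals L_i lies in a finite sum of ideals M_j, then each L_i
   is zero or lies in a single M_j. A descending chain of sums thus becomes,
   after adjoining {0} to each summand set, a chain of finite sets X_n in which
   every member of X_(n+1) lies below a member of X_n. When the members range
   over a well-founded order, such a chain stabilizes up to mutual domination:
   a chain starting from a finite set splits into chains starting from single
   elements, and a chain starting from {L} either keeps an element above L
   forever or reaches a finite set of elements strictly below L. *)
Require Import Defs.
From mathcomp Require Import all_boot all_order all_algebra.
From mathcomp Require Import classical_sets.
From mathcomp Require Import boolp cardinality fsbigop.

Set Implicit Arguments.
Unset Strict Implicit.
Unset Printing Implicit Defensive.
Import GRing.Theory.
Local Open Scope classical_set_scope.
Local Open Scope ring_scope.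

(** * Descending chains of finite sets under refinement *)

Definition refines (T : Type) (X Y : set (set T)) : Prop :=
  forall L, X L -> exists2 M, Y M & L `<=` M.

(** The first term of the chain is fixed to [Y] so that stabilization can be proved by induction on
    [Y]: over unions, and over [L] when [Y] is a singleton. *)
Definition stabilizes_below (T : Type) (P : set (set T)) (Y : set (set T)) :=
  forall X : nat -> set (set T),
    X 0%N = Y -> (forall n, finite_set (X n)) -> (forall n, X n `<=` P) ->
    (forall n, refines (X n.+1) (X n)) ->
    exists N, forall n, (N <= n)%N -> refines (X N) (X n).

(** If [Q] failed somewhere on [P], every counterexample would have a strictly smaller one, and
    dependent choice would yield a strictly descending chain in [P]. *)
Lemma dcc_ind (T : Type) (P Q : set (set T)) : dcc P ->
  (forall L, P L -> (forall M, P M -> M `<` L -> Q M) -> Q L) -> P `<=` Q.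
Proof.
move=> dccP step L0 PL0; apply: contrapT => nQL0.
pose bad := {L : set T | P L /\ ~ Q L}.
have next (L : bad) : {M : bad | sval M `<` sval L}.
  apply: cid; apply: contrapT => noM; case: L noM => L [PL nQL] /= noM.
  apply: (nQL); apply: (step _ PL) => M PM ML; apply: contrapT => nQM.
  by apply: noM; exists (exist _ M (conj PM nQM)).
have [f [_ fS]] := dependent_choice next (exist _ L0 (conj PL0 nQL0) : bad).
have [||N /(_ N.+1 (leqnSn N)) fN] := dccP (fun n => sval (f n)).
- by move=> n; case: (svalP (f n)).
- by move=> n; case: (fS n).
by case: (fS N) => _; apply; rewrite fN.
Qed.

Lemma stabilizes_below0 (T : Type) (P : set (set T)) : stabilizes_below P set0.
Proof. by move=> X X0 _ _ _; exists 0%N => n _ L; rewrite X0. Qed.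

(* A chain starting from a union is split by following, through the successive
   refinements, the descendants of each of the two parts. *)
Lemma stabilizes_belowU (T : Type) (P Y Z : set (set T)) :
  stabilizes_below P Y -> stabilizes_below P Z -> stabilizes_below P (Y `|` Z).
Proof.
move=> stY stZ X X0 finX XP refX.
pose desc W := fix F n : set (set T) :=
  if n is m.+1 then X m.+1 `&` [set L | exists2 M, F m M & L `<=` M] else W.
have descX W : W `<=` X 0%N -> forall n, desc W n `<=` X n.
  by move=> WX [|n] //= L [].
have descN W : stabilizes_below P W -> W `<=` X 0%N ->
    exists N, forall n, (N <= n)%N -> refines (desc W N) (desc W n).
  move=> stW /descX dX; apply: stW => // [n|n|n L [] //].
  - exact: sub_finite_set (dX n) (finX n).
  - exact: subset_trans (dX n) (XP n).
have XE n : X n `<=` desc Y n `|` desc Z n.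
  elim: n => [|n IHn] L; first by rewrite X0.
  move=> XL; have [M /IHn[YM|ZM] LM] := refX n L XL.
  - by left; split=> //; exists M.
  - by right; split=> //; exists M.
have YX0 : Y `<=` X 0%N by rewrite X0; left.
have ZX0 : Z `<=` X 0%N by rewrite X0; right.
have desc_anti W n m : (n <= m)%N -> refines (desc W m) (desc W n).
  elim: m => [|m IHm]; first by rewrite leqn0 => /eqP-> L WL; exists L.
  rewrite leq_eqVlt => /predU1P[->|/IHm mn] L; first by move=> WL; exists L.
  by move=> [_ [M /mn[K WK MK] LM]]; exists K => //; apply: subset_trans MK.
have [[N NY] [K KZ]] := (descN Y stY YX0, descN Z stZ ZX0).
exists (maxn N K) => n; rewrite geq_max => /andP[/NY YNn /KZ ZKn] L.
(* The bounds [N] and [K] may differ from their maximum, so [L] first moves back along the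
   descendants to stage [i], and from there to stage [n]. *)
have go W i : W `<=` X 0%N -> (i <= maxn N K)%N ->
    refines (desc W i) (desc W n) -> desc W (maxn N K) L ->
    exists2 M, X n M & L `<=` M.
  move=> /descX dX le_i Win /(desc_anti W _ _ le_i)[M /Win[H WH MH] LM].
  by exists H; [exact: dX WH | exact: subset_trans MH].
case/XE; first exact: go (leq_maxl _ _) YNn.
exact: go (leq_maxr _ _) ZKn.
Qed.

Lemma stabilizes_below_finite (T : Type) (P Y : set (set T)) :
  finite_set Y -> (forall L, Y L -> stabilizes_below P [set L]) ->
  stabilizes_below P Y.
Proof.
move=> /finite_seqP[s ->]; elim: s => [|L s IHs] stY.
  by rewrite classical_sets.set_nil; exact: stabilizes_below0.
have -> : [set` L :: s] = [set L] `|` [set` s].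
  by apply/funext => M; apply/propext; rewrite /= inE; split=> /predU1P.
apply: stabilizes_belowU.
  by apply: stY; rewrite /= mem_head.
by apply: IHs => M /= sM; apply: stY; rewrite /= inE sM orbT.
Qed.

Lemma dcc_stabilizes_below1 (T : Type) (P : set (set T)) : dcc P ->
  P `<=` [set L | stabilizes_below P [set L]].
Proof.
move=> /dcc_ind; apply=> L PL IH X X0 finX XP refX.
(* If [L] stays below some member of every [X n], the index 0 works, since [X 0] is the singleton of
   [L]. Otherwise let [k] be a stage where this fails. *)
have [LX|/existsNP[k nLX]] := pselect (forall n, refines [set L] (X n)).
  by exists 0%N => n _; rewrite X0.
have Xsub n M : X n M -> M `<=` L.
  elim: n M => [|n IHn] M; first by rewrite X0 => ->.
  by move=> /refX[K /IHn KL MK]; apply: subset_trans KL.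
(* Members of [X k] lie inside [L], and none contains [L] by the choice of [k], so the induction
   hypothesis covers each of them. *)
have stXk : stabilizes_below P (X k).
  apply: stabilizes_below_finite => // M XM; apply: IH; first exact: XP XM.
  by split; [exact: Xsub XM | move=> LM; apply: nLX => _ ->; exists M].
have [||||N XN] := stXk (fun n => X (k + n)%N).
- by rewrite addn0.
- by [].
- by move=> n; apply: XP.
- by move=> n; rewrite addnS.
exists (k + N)%N => n kNn; have := XN (n - k)%N.
by rewrite subnKC ?leq_subRL ?(leq_trans (leq_addr _ _) kNn) //; apply.
Qed.

Lemma dcc_refines (T : Type) (P : set (set T)) (X : nat -> set (set T)) :
  dcc P -> (forall n, finite_set (X n)) -> (forall n, X n `<=` P) ->
  (forall n, refines (X n.+1) (X n)) ->
  exists N, forall n, (N <= n)%N -> refines (X N) (X n).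
Proof.
move=> dccP finX XP; apply: (stabilizes_below_finite (finX 0%N)) => // L XL.
exact: dcc_stabilizes_below1 (XP 0%N _ XL).
Qed.

(** * Finite sums of ideals and sh-ideals *)

Section Ideals.
Variable R : nzRingType.
Implicit Types (A B I J L : set R) (D : set (set R)).

Lemma two_sided_idealD I x y : two_sided_ideal I -> I x -> I y -> I (x + y).
Proof.
case=> I0 IB _ _ Ix Iy; rewrite -[y]opprK; apply: (IB) => //.
by rewrite -sub0r; apply: IB.
Qed.

Lemma two_sided_ideal0 : two_sided_ideal [set 0 : R].
Proof.
split=> // [x y -> ->|a x ->|a x ->] /=; by rewrite ?subr0 ?mulr0 ?mul0r.
Qed.

Lemma sh_ideal0 : sh_ideal [set 0 : R].
Proof.
split; first exact: two_sided_ideal0.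
by move=> A B [A0 _ _ _] _ _; left=> _ ->.
Qed.

Lemma two_sided_ideal_add A B :
  two_sided_ideal A -> two_sided_ideal B -> two_sided_ideal (ideal_add A B).
Proof.
move=> [A0 AB Al Ar] [B0 BB Bl Br]; split.
- by exists 0 => //; exists 0; rewrite ?addr0.
- move=> _ _ [a Aa [b Bb <-]] [c Ac [d Bd <-]].
  exists (a - c); first exact: AB.
  by exists (b - d); [exact: BB | rewrite opprD addrACA].
- move=> r _ [a Aa [b Bb <-]]; exists (r * a); first exact: Al.
  by exists (r * b); [exact: Bl | rewrite mulrDr].
- move=> r _ [a Aa [b Bb <-]]; exists (a * r); first exact: Ar.
  by exists (b * r); [exact: Br | rewrite mulrDl].
Qed.

Lemma two_sided_ideal_sum D : finite_set D -> D `<=` @two_sided_ideal R ->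
  two_sided_ideal (ideal_sum D).
Proof.
move=> finD DI; split.
- exists (fun=> 0); split; first by move=> L /DI[].
  by rewrite fsbig1.
- move=> _ _ [f [fD ->]] [g [gD ->]]; exists (fun L => f L - g L); split.
    move=> L DL; case: (DI _ DL) => _ IB _ _.
    by apply: IB; [exact: fD | exact: gD].
  by rewrite !(fsbig_finite _ _ finD) sumrB.
- move=> a _ [f [fD ->]]; exists (fun L => a * f L); split.
    by move=> L DL; case: (DI _ DL) => _ _ Il _; apply: Il; exact: fD.
  by rewrite !(fsbig_finite _ _ finD) mulr_sumr.
- move=> a _ [f [fD ->]]; exists (fun L => f L * a); split.
    by move=> L DL; case: (DI _ DL) => _ _ _ Ir; apply: Ir; exact: fD.
  by rewrite !(fsbig_finite _ _ finD) mulr_suml.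
Qed.

Lemma ideal_sum_sub D J : finite_set D -> two_sided_ideal J ->
  (forall L, D L -> L `<=` J) -> ideal_sum D `<=` J.
Proof.
move=> finD JI DJ _ [f [fD ->]]; rewrite (fsbig_finite _ _ finD) big_seq.
apply: big_ind => [|x y|L]; first by case: JI.
- exact: two_sided_idealD.
- by rewrite in_fset_set // inE => DL; apply: (DJ L DL); apply: fD.
Qed.

Lemma sub_ideal_sum D L : finite_set D -> D `<=` @two_sided_ideal R ->
  D L -> L `<=` ideal_sum D.
Proof.
move=> finD DI DL x Lx; exists (fun M => if M == L then x else 0); split.
  by move=> M /DI[M0 _ _ _]; case: eqP => // ->.
rewrite (fsbigD1 L) //= eqxx fsbig1 ?addr0 // => M [_ /= nML].
by case: eqP.
Qed.

Lemma ideal_sum1 L : two_sided_ideal L -> ideal_sum [set L] = L.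
Proof.
move=> LI; apply/seteqP; split; last first.
  by apply: sub_ideal_sum => // _ ->.
by apply: ideal_sum_sub => // _ ->.
Qed.

(** Summands are split off one at a time, each time applying strong hollowness to one summand plus
    the sum of the rest. The zero ideal accounts for the empty sum, where the induction ends. *)
Lemma sh_ideal_sub_sum D L : finite_set D -> D `<=` @two_sided_ideal R ->
  sh_ideal L -> L `<=` ideal_sum D ->
  exists2 M, ([set 0] |` D) M & L `<=` M.
Proof.
move=> /finite_seqP[s ->]; elim: s => [|M s IHs] DI shL Lsum.
  exists [set 0]; first by left.
  apply: (subset_trans Lsum); apply: ideal_sum_sub => //.
  exact: two_sided_ideal0.
have MI : two_sided_ideal M by apply: DI; rewrite /= mem_head.
have sI : [set` s] `<=` @two_sided_ideal R.
  by move=> N /= sN; apply: DI; rewrite /= inE sN orbT.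
have SI : two_sided_ideal (ideal_sum [set` s]).
  exact: two_sided_ideal_sum.
have [| LM | /(IHs sI shL)[N [N0|sN] LN]] := shL.2 M _ MI SI.
(* Inclusion of the whole sum in [M] plus the rest suffices, so it does no harm if [M] recurs in
   [s]. *)
- apply: (subset_trans Lsum); apply: ideal_sum_sub => //.
    exact: two_sided_ideal_add.
  move=> N; rewrite /= inE => /predU1P[->|sN] x Nx.
    by exists x => //; exists 0; [case: SI | rewrite addr0].
  exists 0; first by case: MI.
  by exists x; [exact: (sub_ideal_sum _ _ sN) | rewrite add0r].
- by exists M => //; right; rewrite /= mem_head.
- by exists N => //; left.
- by exists N => //; right; rewrite /= inE sN orbT.
Qed.

End Ideals.

Theorem proposition2p7 (R : nzRingType) :
  dcc (@sh_ideal R) <-> dcc (@incomparable_sh_sum R).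
Proof.
split=> [dccP I sumI decI|dccS I shI decI]; last first.
  (* Each sh-ideal is the sum of the family consisting of itself alone. *)
  apply: dccS decI => n; exists [set I n]; split=> //.
  - by move=> _ ->.
  - by move=> L M -> ->.
  - by rewrite ideal_sum1 //; case: (shI n).
have {sumI} [D DP] := choice sumI.
have finD n : finite_set (D n) by case: (DP n).
have shD n : D n `<=` @sh_ideal R by case: (DP n).
have ID n : D n `<=` @two_sided_ideal R by move=> L /shD[].
have IE n : I n = ideal_sum (D n) by case: (DP n).
have [||n L [->|DL]|N XN] := @dcc_refines _ _ (fun n => [set 0] |` D n) dccP.
- by move=> n; rewrite finite_setU.
- by move=> n L [->|/shD //]; exact: sh_ideal0.
- by exists [set 0] => //; left.
- apply: sh_ideal_sub_sum => //; first exact: shD DL.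
  by rewrite -IE; apply: subset_trans (decI n); rewrite IE; exact: sub_ideal_sum.
exists N => n Nn; apply/seteqP; split.
  rewrite -(subnKC Nn); elim: (n - N)%N => [|k IHk]; first by rewrite addn0.
  by rewrite addnS; apply: subset_trans IHk.
(* It remains to see that [I N] lies in [I n]: each summand of [I N] is below zero or a summand of
   [I n]. *)
have InI : two_sided_ideal (ideal_sum (D n)) by exact: two_sided_ideal_sum.
rewrite !IE; apply: ideal_sum_sub => // L DL.
have [|M [->|DM] LM] := XN n Nn L; first by right.
- by apply: (subset_trans LM) => _ ->; case: InI.
- by apply: (subset_trans LM); exact: sub_ideal_sum.
Qed.
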